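(* Let $\mathcal{E}$ be an evolution algebra over $\mathbb{K}$, and let $r\geq 1$ be the number of steps until the $\mathcal{E}$-supersolvable nilpotent series $0\subseteq\mathcal{N}^1(\mathcal{E})\subseteq\mathcal{N}^2(\mathcal{E})\subseteq\cdots$ stabilises (so $\mathcal{N}^r(\mathcal{E})=\mathcal{N}^{r+1}(\mathcal{E})=\cdots$). If $I$ is a nilpotent ideal of $\mathcal{E}$, then $I+\mathcal{N}^r(\mathcal{E})$ is also a nilpotent ideal of $\mathcal{E}$.
   Context: $\mathbb{K}$ is a field of characteristic different from $2$. An evolution algebra over $\mathbb{K}$ is a finite-dimensional $\mathbb{K}$-algebra (commutative, not necessarily associative) having a basis $B=\{e_1,\dots,e_n\}$, called a natural basis, with $e_ie_j=0$ for $i\neq j$; a natural basis $B$ of $\mathcal{E}$ is fixed. For $u=\sum\mu_ie_i$, $\operatorname{supp}(u)=\{i:\mu_i\neq0\}$, and for a subspace $U$, $\operatorname{supp}(U)=\bigcup_{u\in U}\operatorname{supp}(u)$. $\operatorname{ann}(\mathcal{A})=\{u\in\mathcal{A}: u\mathcal{A}=0\}$. For an algebra $\mathcal{A}$ put $\mathcal{A}^1=\mathcal{A}$, $\mathcal{A}^{m+1}=\sum_{i=1}^m\mathcal{A}^i\mathcal{A}^{m+1-i}$, and $\mathcal{A}^{(1)}=\mathcal{A}$, $\mathcal{A}^{(m+1)}=\mathcal{A}^{(m)}\mathcal{A}^{(m)}$; $\mathcal{A}$ is nilpotent (solvable) if $\mathcal{A}^m=0$ (resp. $\mathcal{A}^{(m)}=0$)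 for some $m$; $\mathcal{A}^2$ is the derived subalgebra; an ideal is nilpotent if it is so as an algebra, and an ideal $I$ is abelian if $I^2=0$. $\mathcal{T}_{\mathbb{K}}$ is the class of solvable, non-nilpotent evolution algebras over $\mathbb{K}$ with one-dimensional derived subalgebra; every $\mathcal{A}\in\mathcal{T}_{\mathbb{K}}$ has a unique maximal nilpotent ideal, denoted $\operatorname{Nil}(\mathcal{A})$. The $\mathcal{E}$-supersolvable nilpotent series is defined inductively, with $\mathcal{N}^0(\mathcal{E})=0$. Given the ideal $\mathcal{N}^{i-1}=\mathcal{N}^{i-1}(\mathcal{E})$, $i\ge1$, consider all ideals of $\mathcal{E}$ of the form $J=\operatorname{span}\{w\}+\mathcal{N}^{i-1}$ of dimension $1+\dim\mathcal{N}^{i-1}$ with $w^2\in\mathcal{N}^{i-1}$ and $\operatorname{supp}(w)\cap\operatorname{supp}(\mathcal{N}^{i-1})=\emptyset$ (for $i=1$ these are exactly the one-dimensional abelian ideals of $\mathcal{E}$). Then $\overline{J}=J/\mathcal{N}^{i-1}$ is a one-dimensional abelian ideal of the evolution algebra $\mathcal{E}/\mathcal{N}^{i-1}$, and either (a) $\overline{J}\subseteq\operatorname{ann}(\mathcal{E}/\mathcal{N}^{i-1})$, or (b) $\overline{J}$ is the derived subalgebra of the ideal $\mathcal{E}_J=\operatorname{span}\{\overline{e_k}: k\in\operatorname{supp}(w)\}$ of $\mathcal{E}/\mathcal{N}^{i-1}$, with $\mathcal{E}_J\in\mathcal{T}_{\mathbb{K}}$. The ideal $\mathcal{N}^i(\mathcal{E})\supseteq\mathcal{N}^{i-1}$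 is defined by $$\mathcal{N}^i(\mathcal{E})/\mathcal{N}^{i-1}(\mathcal{E})=\sum_{J\text{ of type (b)}}\operatorname{Nil}(\mathcal{E}_J)+\sum_{J\text{ of type (a)}}\overline{J}.$$ *)

(* Defs.v *)
From HB Require Import structures.
From mathcomp Require Import all_boot all_order all_algebra.
From mathcomp Require Import boolp.

Set Implicit Arguments.
Unset Strict Implicit.
Unset Printing Implicit Defensive.

Import GRing.Theory.
Local Open Scope ring_scope.

(* Finite-dimensional commutative, not necessarily associative algebras.
   Linearity in the left argument follows from commutativity. *)
Record calgebra (K : fieldType) := CAlgebra {
  calg_sort :> vectType K;
  amul : calg_sort -> calg_sort -> calg_sort;
  amulC : commutative amul;
  amul_linear : forall a, linear (amul a)
}.

Section Algebra.
Variables (K : fieldType) (A : calgebra K).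
Implicit Types (u v w : A) (U V W : {vspace A}).

HB.instance Definition _ u :=
  GRing.isSemilinear.Build K A A _ (amul u)
    (GRing.semilinear_linear (amul_linear u)).

Definition mulv U V : {vspace A} :=
  <<[seq amul u v | u <- vbasis U, v <- vbasis V]>>%VS.

Lemma memv_amul U V u v : u \in U -> v \in V -> amul u v \in mulv U V.
Proof.
move=> uU vV; rewrite (coord_vbasis vV) linear_sum memv_suml // => j _.
rewrite linearZ memvZ //= amulC (coord_vbasis uU) linear_sum memv_suml // => i _.
rewrite linearZ memvZ //= amulC memv_span //.
by apply/allpairsP; exists ((vbasis U)`_i, (vbasis V)`_j);
  split=> //=; rewrite mem_nth // size_tuple.
Qed.

Lemma mulvP U V W :
  reflect (forall u v, u \in U -> v \in V -> amul u v \in W) (mulv U V <= W)%VS.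
Proof.
apply: (iffP idP) => [/subvP UVW u v uU vV | UVW].
  exact/UVW/memv_amul.
apply/span_subvP => _ /allpairsP[[u v] /= [uU vV ->]].
by apply: UVW; apply: vbasis_mem.
Qed.

(* One-sided condition: multiplication is commutative. *)
Definition is_ideal U : bool := (mulv fullv U <= U)%VS.

Definition in_ann u : Prop := forall v, amul u v = 0.

Definition derived : {vspace A} := mulv fullv fullv.

(* [:: A^1; ...; A^m.+1] *)
Fixpoint powers (m : nat) : seq {vspace A} :=
  if m is m'.+1 then
    let s := powers m' in
    rcons s (\sum_(i < m) mulv (nth 0 s i) (nth 0 s (m' - i)%N))%VS
  else [:: fullv].

(* A^m, for m >= 1; see apowE for the defining recursion. *)
Definition apow (m : nat) : {vspace A} := nth 0%VS (powers m.-1) m.-1.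

Lemma size_powers m : size (powers m) = m.+1.
Proof. by elim: m => //= m IH; rewrite size_rcons IH. Qed.

Lemma nth_powers m i : (i <= m)%N -> nth 0%VS (powers m) i = apow i.+1.
Proof.
elim: m => [|m IH]; first by rewrite leqn0 => /eqP->.
rewrite leq_eqVlt => /predU1P[-> // | lt_im].
by rewrite /= nth_rcons size_powers lt_im IH.
Qed.

Lemma apow1 : apow 1 = fullv. Proof. by []. Qed.

Lemma apowE m : (0 < m)%N ->
  apow m.+1 = (\sum_(1 <= i < m.+1) mulv (apow i) (apow (m.+1 - i)%N))%VS.
Proof.
case: m => // m _; rewrite {1}/apow /= nth_rcons size_powers ltnn eqxx.
rewrite big_add1 big_mkord; apply: eq_bigr => -[i /= lt_i] _.
rewrite !nth_powers ?leq_subr // subSS.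
by congr (mulv _ (apow _)); rewrite subSn.
Qed.

Definition nilpotent : Prop := exists2 m, (0 < m)%N & apow m = 0%VS.

(* [dpow m] is A^(m), for m >= 1. *)
Definition dpow (m : nat) : {vspace A} := iter m.-1 (fun U => mulv U U) fullv.

Definition solvable : Prop := exists2 m, (0 < m)%N & dpow m = 0%VS.

Definition natural_basis n (B : n.-tuple A) : Prop :=
  basis_of fullv B /\ (forall i j : 'I_n, i != j -> amul B`_i B`_j = 0).

Definition is_evolution : Prop := exists n (B : n.-tuple A), natural_basis B.

(* The class T_K. *)
Definition inT : Prop :=
  [/\ is_evolution, solvable, ~ nilpotent & \dim derived = 1%N].

Definition supp n (B : n.-tuple A) u : {set 'I_n} := [set i | coord B i u != 0].

Definition suppv n (B : n.-tuple A) U : {set 'I_n} :=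
  [set i | `[< exists2 u, u \in U & i \in supp B u >]].

End Algebra.

(* The product of A restricted to U; [vsproj U] only serves to land in
   [subvs_of U] and acts as the identity when U is closed under products. *)
Section Subalgebra.
Variables (K : fieldType) (A : calgebra K) (U : {vspace A}).

Definition sub_mul (x y : subvs_of U) : subvs_of U :=
  vsproj U (amul (vsval x) (vsval y)).

Fact sub_mulC : commutative sub_mul.
Proof. by move=> x y; rewrite /sub_mul amulC. Qed.

Fact sub_mul_linear x : linear (sub_mul x).
Proof. by move=> a y z; rewrite /sub_mul !linearP. Qed.

Definition subalg : calgebra K := CAlgebra sub_mulC sub_mul_linear.

Definition sub_incl : 'Hom(subalg, A) := linfun (vsval : subvs_of U -> A).

Lemma sub_inclM x y : (mulv U U <= U)%VS ->
  sub_incl (amul x y) = amul (sub_incl x) (sub_incl y).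
Proof.
move=> /mulvP UU; rewrite !lfunE /= vsprojK //.
by apply: UU; apply: subvsP.
Qed.

End Subalgebra.

(* The quotient A / U, realised on the complement U^C of U; [quo_pi] is the
   projection along U, and a morphism of algebras when U is an ideal. *)
Section Quotient.
Variables (K : fieldType) (A : calgebra K) (U : {vspace A}).

Definition quo_proj (u : A) : subvs_of (U^C)%VS :=
  vsproj (U^C)%VS (u - projv U u).

Fact quo_proj_linear : linear quo_proj.
Proof.
move=> a u v; rewrite /quo_proj -linearP; congr (vsproj _ _).
by rewrite linearP scalerBr opprD addrACA.
Qed.

HB.instance Definition _ :=
  GRing.isSemilinear.Build K A (subvs_of (U^C)%VS) _ quo_proj
    (GRing.semilinear_linear quo_proj_linear).

Definition quo_mul (x y : subvs_of (U^C)%VS) : subvs_of (U^C)%VS :=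
  quo_proj (amul (vsval x) (vsval y)).

Fact quo_mulC : commutative quo_mul.
Proof. by move=> x y; rewrite /quo_mul amulC. Qed.

Fact quo_mul_linear x : linear (quo_mul x).
Proof. by move=> a y z; rewrite /quo_mul !linearP. Qed.

Definition quoalg : calgebra K := CAlgebra quo_mulC quo_mul_linear.

Definition quo_pi : 'Hom(A, quoalg) := linfun quo_proj.

Lemma quo_piE u : vsval (quo_pi u) = u - projv U u.
Proof. by rewrite lfunE /= vsprojK // memv_projC. Qed.

Lemma quo_pi_eq0 u : (quo_pi u == 0) = (u \in U).
Proof.
rewrite -(inj_eq (@subvs_inj _ _ _)) quo_piE linear0 subr_eq0.
apply/eqP/idP => [-> | uU]; first exact: memv_proj.
by rewrite projv_id.
Qed.

Lemma quo_pi_ker : lker quo_pi = U.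
Proof. by apply/vspaceP => u; rewrite memv_ker quo_pi_eq0. Qed.

Lemma quo_pi_val (x : quoalg) : quo_pi (vsval x) = x.
Proof.
apply: subvs_inj; rewrite quo_piE.
suff -> : projv U (vsval x) = 0 by rewrite subr0.
by apply/eqP; rewrite -memv_ker lker_proj; apply: subvsP.
Qed.

Lemma quo_pi_img : limg quo_pi = fullv.
Proof.
apply/vspaceP => x; rewrite memvf; apply/memv_imgP.
by exists (vsval x); rewrite ?memvf // quo_pi_val.
Qed.

Lemma quo_piM u v : is_ideal U ->
  quo_pi (amul u v) = amul (quo_pi u) (quo_pi v).
Proof.
move=> /mulvP idU.
have -> : amul (quo_pi u) (quo_pi v)
  = quo_pi (amul (vsval (quo_pi u)) (vsval (quo_pi v))) by rewrite [RHS]lfunE.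
apply/eqP; rewrite -subr_eq0 -linearB quo_pi_eq0 !quo_piE.
set p := projv U u; set q := projv U v.
have -> : amul u v - amul (u - p) (v - q) = amul u q + amul (v - q) p.
  rewrite [amul (u - p) _]amulC [amul (v - q) (u - p)]linearB /=.
  rewrite [amul _ u]amulC [amul u (v - q)]linearB /=.
  by rewrite -addrA -opprD opprB addrC addrNK.
by rewrite memvD // idU ?memvf // memv_proj.
Qed.

End Quotient.

Section SumOfSubspaces.
Variables (K : fieldType) (V : vectType K) (P : {vspace V} -> Prop).

Definition is_vsum (S : {vspace V}) : Prop :=
  (forall U, P U -> (U <= S)%VS) /\
  (forall T, (forall U, P U -> (U <= T)%VS) -> (S <= T)%VS).

Lemma vsum_exists : exists S, is_vsum S.
Proof.
pose ub T := forall U, P U -> (U <= T)%VS.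
pose p d := `[< exists2 T, ub T & \dim T = d >].
have exp : exists d, p d.
  by exists (\dim (@fullv _ V)); apply/asboolP; exists fullv => // U _;
    apply: subvf.
case: (ex_minnP exp) => d /asboolP[S ubS dS] mind; exists S; split=> // T ubT.
have ubST : ub (S :&: T)%VS by move=> U PU; rewrite subv_cap ubS ?ubT.
have /mind : p (\dim (S :&: T)) by apply/asboolP; exists (S :&: T)%VS.
rewrite -dS => le_d.
by rewrite -(eqP (_ : (S :&: T)%VS == S)) ?capvSr // eqEdim capvSl.
Qed.

(* The sum of the (possibly infinite) family P of subspaces. *)
Definition vsum : {vspace V} := sval (cid vsum_exists).

Lemma vsumP : is_vsum vsum. Proof. exact: svalP. Qed.

End SumOfSubspaces.

Section Nilradical.
Variables (K : fieldType) (A : calgebra K).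

Definition nilpotent_ideal (I : {vspace A}) : Prop :=
  is_ideal I /\ nilpotent (subalg I).

Definition maximal_nilpotent_ideal (I : {vspace A}) : Prop :=
  nilpotent_ideal I /\
  (forall I', nilpotent_ideal I' -> (I <= I')%VS -> I' = I).

Lemma nilpotent_ideal0 : nilpotent_ideal 0%VS.
Proof.
split.
  by apply/mulvP => u v _; rewrite !memv0 => /eqP->; rewrite linear0.
exists 1%N => //; rewrite apow1; apply/eqP.
by rewrite -subv0; apply/subvP => x _; rewrite memv0 -(inj_eq (@subvs_inj _ _ _))
  linear0 -memv0 subvsP.
Qed.

Lemma maximal_nilpotent_ideal_exists : exists I, maximal_nilpotent_ideal I.
Proof.
pose p d := `[< exists2 I, nilpotent_ideal I & \dim I = d >].
have exp : exists d, p d.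
  by exists (\dim (0 : {vspace A})%VS); apply/asboolP; exists 0%VS => //;
    apply: nilpotent_ideal0.
have lep d : p d -> (d <= \dim (@fullv _ A))%N.
  by case/asboolP => I _ <-; rewrite dimvS ?subvf.
case: (ex_maxnP exp lep) => d /asboolP[I nilI dI] maxd.
exists I; split=> // I' nilI' sII'.
have /maxd le_d : p (\dim I') by apply/asboolP; exists I'.
by apply/eqP; rewrite eq_sym eqEdim sII' dI.
Qed.

(* A maximal nilpotent ideal; there is only one when [inT A]. *)
Definition Nil : {vspace A} := sval (cid maximal_nilpotent_ideal_exists).

Lemma NilP : maximal_nilpotent_ideal Nil. Proof. exact: svalP. Qed.

End Nilradical.

Section Series.
Variables (K : fieldType) (E : calgebra K) (n : nat) (B : n.-tuple E).
Implicit Types (N : {vspace E}) (w : E).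

Definition extension N w : {vspace E} := (<[w]> + N)%VS.

Definition is_extension N w : Prop :=
  [/\ is_ideal (extension N w), \dim (extension N w) = (1 + \dim N)%N,
      amul w w \in N & [disjoint supp B w & suppv B N]].

Definition Jbar N w : {vspace quoalg N} := (quo_pi N @: extension N w)%VS.

Definition EJ N w : {vspace quoalg N} :=
  <<[seq quo_pi N B`_k | k : 'I_n in supp B w]>>%VS.

Definition type_a N w : Prop := forall x, x \in Jbar N w -> in_ann x.

Definition type_b N w : Prop :=
  [/\ is_ideal (EJ N w), inT (subalg (EJ N w))
    & Jbar N w = (sub_incl (EJ N w) @: derived (subalg (EJ N w)))%VS].

Definition NilEJ N w : {vspace quoalg N} :=
  (sub_incl (EJ N w) @: Nil (subalg (EJ N w)))%VS.

Definition summand N (V : {vspace quoalg N}) : Prop :=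
  exists2 w, is_extension N w &
    (type_b N w /\ V = NilEJ N w) \/ (type_a N w /\ V = Jbar N w).

(* The subspace N' containing N such that N' / N is the sum of the summands. *)
Definition series_step N : {vspace E} := (quo_pi N @^-1: vsum (@summand N))%VS.

Definition nil_series (i : nat) : {vspace E} := iter i series_step 0%VS.

Definition stable_from (r : nat) : Prop :=
  (0 < r)%N /\ (forall s, (r <= s)%N -> nil_series s = nil_series r).

Definition stabilises_at (r : nat) : Prop :=
  stable_from r /\ (forall s, stable_from s -> (r <= s)%N).

Lemma sub_series_step N : (N <= series_step N)%VS.
Proof.
apply/subvP => u uN; rewrite -memv_preim.
have /eqP-> : quo_pi N u == 0 by rewrite quo_pi_eq0.
exact: mem0v.
Qed.

Lemma stabilises_at_exists : exists r, stabilises_at r.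
Proof.
have stab s : nil_series s.+1 = nil_series s ->
    forall t, (s <= t)%N -> nil_series t = nil_series s.
  move=> eqs t; elim: t => [|t IH]; first by rewrite leqn0 => /eqP->.
  rewrite leq_eqVlt => /predU1P[<- // | /IH eqt].
  by rewrite [LHS]/= -/(nil_series t) eqt.
have [s eqs] : exists s, nil_series s.+1 = nil_series s.
  apply: contrapT => neq.
  have grow s : (s <= \dim (nil_series s))%N.
    elim: s => // s IH; apply: leq_ltn_trans IH _.
    rewrite ltn_neqAle dimvS ?sub_series_step // andbT.
    apply/eqP => eqd; apply: neq; exists s; apply/esym/eqP.
    by rewrite eqEdim sub_series_step -[nil_series s.+1]/(series_step _) -eqd /=.
  have := grow (\dim (@fullv _ E)).+1.
  by rewrite leqNgt ltnS dimvS ?subvf.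
have ex : exists r, `[< stable_from r >].
  exists s.+1; apply/asboolP; split=> // t lt_st.
  by rewrite (stab s eqs) ?(ltnW lt_st) // eqs.
case: (ex_minnP ex) => r /asboolP str minr; exists r; split=> // t stt.
by apply: minr; apply/asboolP.
Qed.

End Series.

(* Main.v *)
(** A subalgebra [M] is nilpotent as soon as the left-normed powers
    [M (M (... M))] vanish.  If [M] is a nilpotent ideal containing [N] and
    [<[w]> + N] is an ideal with [w] not in [N], then [M w] lies in [N]:
    otherwise some [u] in [M] acts on [w] modulo [N] by a nonzero scalar, which
    forces [w] into [M] and contradicts nilpotency.  A summand of the series
    over [N] lifts to [U + N], with [U] inside the span of the [e_k], [k] in
    [supp w]; the disjointness of supports gives [U N = 0], and moreover
    [U E <= <[w]> + N] and [U w <= N].  Hence the left-normed powers of [M + U]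
    are those of [M] up to [<[w]> + N], then fall into [N], where [U] acts by
    zero; so [M + U] is again nilpotent.  Therefore a maximal nilpotent ideal
    containing [I] absorbs every term of the series. *)

Require Import Defs.
From mathcomp Require Import all_boot all_order all_algebra.
From mathcomp Require Import boolp.

Set Implicit Arguments.
Unset Strict Implicit.
Unset Printing Implicit Defensive.

Import GRing.Theory.
Local Open Scope ring_scope.

(** * Products of subspaces and left-normed powers *)

Section Products.
Variables (K : fieldType) (A : calgebra K).
Implicit Types (u v w : A) (U V W M N : {vspace A}).

Lemma mulv_comm U V : mulv U V = mulv V U.
Proof.
by apply: subv_anti; apply/andP; split; apply/mulvP => u v uU vV;
  rewrite amulC memv_amul.
Qed.

Lemma mulvS U U' V V' :
  (U <= U')%VS -> (V <= V')%VS -> (mulv U V <= mulv U' V')%VS.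
Proof.
move=> /subvP sU /subvP sV; apply/mulvP => u v uU vV.
by rewrite memv_amul ?sU ?sV.
Qed.

Lemma mulvDr U V W : mulv U (V + W) = (mulv U V + mulv U W)%VS.
Proof.
apply: subv_anti; apply/andP; split; last first.
  by rewrite subv_add !mulvS ?addvSl ?addvSr.
apply/mulvP => u _ uU /memv_addP[v vV [w wW ->]].
by rewrite linearD memv_add ?memv_amul.
Qed.

Lemma mulvDl U V W : mulv (U + V) W = (mulv U W + mulv V W)%VS.
Proof. by rewrite mulv_comm mulvDr !(mulv_comm W). Qed.

Lemma ideal_mulvl U M : is_ideal M -> (mulv U M <= M)%VS.
Proof. by apply: subv_trans; rewrite mulvS ?subvf. Qed.

Lemma ideal_mulvr U M : is_ideal M -> (mulv M U <= M)%VS.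
Proof. by rewrite mulv_comm; apply: ideal_mulvl. Qed.

Lemma ideal_addv M N : is_ideal M -> is_ideal N -> is_ideal (M + N)%VS.
Proof. by move=> iM iN; rewrite /is_ideal mulvDr addvS. Qed.

(* [lpow M m] is the left-normed power with m + 1 factors. *)
Definition lpow M (m : nat) : {vspace A} := iter m (mulv M) M.

Lemma lpow_mono M N m : (M <= N)%VS -> (lpow M m <= lpow N m)%VS.
Proof. by move=> sMN; elim: m => //= m IH; apply: mulvS. Qed.

Lemma lpow_sub_apow m : (lpow fullv m <= apow A m.+1)%VS.
Proof.
elim: m => [|m IH]; first by rewrite apow1.
rewrite apowE // big_nat_recl // subSS subn0.
by apply: subv_trans (addvSl _ _); rewrite apow1 mulvS.
Qed.

(** When [2 ^ m.+1 <= k], each product of powers with indices adding up to [k] has a factor of index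
    at least [2 ^ m]. Commutativity moves that factor to the right, where induction applies; the
    other factor is bounded by the whole algebra. *)
Lemma apow_sub_lpow m k : (2 ^ m <= k)%N -> (apow A k <= lpow fullv m)%VS.
Proof.
elim: m k => [|m IH] k; first by rewrite subvf.
rewrite expnS mul2n -addnn => le_k.
have p2 : (0 < 2 ^ m)%N by rewrite expn_gt0.
case: k le_k => [|k] le_k.
  by move: le_k; rewrite leqn0 addn_eq0 andbb -leqn0 leqNgt p2.
have k_gt0 : (0 < k)%N by rewrite -ltnS (leq_trans _ le_k) // (leq_add p2 p2).
rewrite apowE // big_seq; apply: (big_ind (fun V => V <= lpow fullv m.+1)%VS).
- exact: sub0v.
- by move=> U V sU sV; rewrite subv_add sU.
move=> i; rewrite mem_index_iota ltnS => /andP[_ le_ik].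
have [le_i|lt_i] := leqP (2 ^ m) i.
  by rewrite mulv_comm /= mulvS ?subvf ?IH.
rewrite /= mulvS ?subvf ?IH // leq_subRL ?(leq_trans le_ik) //.
by apply: leq_trans le_k; rewrite leq_add2r ltnW.
Qed.

Lemma nilpotent_lpow : nilpotent A <-> exists m, lpow fullv m = 0%VS :> {vspace A}.
Proof.
split=> [[[//|m] _ Am0]|[m Am0]].
  by exists m; apply/eqP; rewrite -subv0 -Am0 lpow_sub_apow.
exists (2 ^ m)%N; first by rewrite expn_gt0.
by apply/eqP; rewrite -subv0 -Am0 apow_sub_lpow.
Qed.

End Products.

(** * Nilpotent ideals and their enlargement *)

Section Nilpotent.
Variables (K : fieldType) (A : calgebra K).
Implicit Types (u v w : A) (U V W M N : {vspace A}).

Lemma sub_inclE M (x : subalg M) : sub_incl M x = vsval x.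
Proof. by rewrite lfunE. Qed.

Lemma sub_incl_inj M : injective (sub_incl M).
Proof. by move=> x y; rewrite !sub_inclE; apply: subvs_inj. Qed.

Lemma sub_incl_in M (x : subalg M) : sub_incl M x \in M.
Proof. by rewrite sub_inclE subvsP. Qed.

Lemma limg_sub_incl M : limg (sub_incl M) = M.
Proof.
apply: subv_anti; apply/andP; split; apply/subvP => u.
  by case/memv_imgP => x _ ->; apply: sub_incl_in.
move=> uM; apply/memv_imgP; exists (vsproj M u : subalg M); rewrite ?memvf //.
by rewrite sub_inclE vsprojK.
Qed.

Lemma sub_incl_mulv M (U V : {vspace subalg M}) : (mulv M M <= M)%VS ->
  (sub_incl M @: mulv U V)%VS = mulv (sub_incl M @: U) (sub_incl M @: V).
Proof.
move=> MM; apply: subv_anti; apply/andP; split; last first.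
  apply/mulvP => _ _ /memv_imgP[x xU ->] /memv_imgP[y yV ->].
  by rewrite -sub_inclM // memv_img ?memv_amul.
apply/subvP => _ /memv_imgP[z zUV ->]; rewrite memv_preim.
apply: subvP zUV; apply/mulvP => x y xU yV.
by rewrite -memv_preim sub_inclM // memv_amul ?memv_img.
Qed.

(** The injective morphism [sub_incl M] carries the left-normed powers of [subalg M] to those of
    [M], so nilpotency can be tested inside [A]. *)
Lemma nilpotent_subalgP M : (mulv M M <= M)%VS ->
  nilpotent (subalg M) <-> exists m, lpow M m = 0%VS.
Proof.
move=> MM; rewrite nilpotent_lpow.
have imgE m : (sub_incl M @: lpow fullv m)%VS = lpow M m.
  elim: m => [|m IH] /=; first exact: limg_sub_incl.
  by rewrite sub_incl_mulv // -/(lpow _ _) IH limg_sub_incl.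
split=> -[m m0]; exists m; first by rewrite -imgE m0 limg0.
apply/eqP; rewrite -subv0; apply/subvP => x /(memv_img (sub_incl M)).
by rewrite imgE m0 !memv0 -(inj_eq (@sub_incl_inj M)) linear0.
Qed.

Lemma nilpotent_idealP M :
  nilpotent_ideal M <-> is_ideal M /\ exists m, lpow M m = 0%VS.
Proof.
by split=> -[iM nM]; split=> //; apply/nilpotent_subalgP => //;
  apply: ideal_mulvl.
Qed.

Lemma nilpotent_idealS M N :
  is_ideal M -> (M <= N)%VS -> nilpotent_ideal N -> nilpotent_ideal M.
Proof.
move=> iM sMN /nilpotent_idealP[_ [m m0]]; apply/nilpotent_idealP; split=> //.
by exists m; apply/eqP; rewrite -subv0 -m0 lpow_mono.
Qed.

Lemma maximal_nilpotent_ideal_above I : nilpotent_ideal I ->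
  exists2 M : {vspace A}, maximal_nilpotent_ideal M & (I <= M)%VS.
Proof.
move=> nilI; pose p d := `[< exists M : {vspace A},
  [/\ nilpotent_ideal M, (I <= M)%VS & \dim M = d] >].
have exp : exists d, p d by exists (\dim I); apply/asboolP; exists I.
have lep d : p d -> (d <= \dim (@fullv _ A))%N.
  by case/asboolP => M [_ _ <-]; rewrite dimvS ?subvf.
case: (ex_maxnP exp lep) => d /asboolP[M [nilM sIM dM]] maxd.
exists M => //; split=> // M' nilM' sMM'.
have /maxd le_d : p (\dim M').
  by apply/asboolP; exists M'; split=> //; apply: subv_trans sMM'.
by apply/eqP; rewrite eq_sym eqEdim sMM' dM.
Qed.

Lemma nilpotent_ideal_mul_line M N w :
    nilpotent_ideal M -> is_ideal N -> (N <= M)%VS -> w \notin N ->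
    (mulv M <[w]> <= <[w]> + N)%VS ->
  (mulv M <[w]> <= N)%VS.
Proof.
move=> /nilpotent_idealP[iM [m m0]] iN sNM wN /mulvP MwN.
have Mw u : u \in M -> amul u w \in N.
  move=> uM; have := MwN u w uM (memv_line w).
  case/memv_addP => _ /vlineP[c ->] [x xN uw].
  have [c0|c0] := eqVneq c 0; first by rewrite uw c0 scale0r add0r.
  have wM : w \in M.
    have -> : w = c^-1 *: (amul u w - x) by rewrite uw addrK scalerK.
    rewrite memvZ // memvB ?(subvP sNM x) //.
    by rewrite (subvP (ideal_mulvr fullv iM)) ?memv_amul ?memvf.
  (* Iterating [amul u] on [w] descends through the powers of [M], yet gives [c ^+ j *: w] modulo
     [N]. At [j = m] the iterate is zero, which puts [w] in [N]. *)
  have iterM j : iter j (amul u) w \in lpow M j.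
    by elim: j => //= j IH; rewrite memv_amul.
  have iterN j : iter j (amul u) w - c ^+ j *: w \in N.
    elim: j => [|j IH]; first by rewrite expr0 scale1r subrr mem0v.
    rewrite iterS exprSr -scalerA.
    have -> : c *: w = amul u w - x by rewrite uw addrK.
    rewrite scalerBr opprB addrCA addrC -linearZ -linearB memvD ?memvZ //.
    by rewrite (subvP (ideal_mulvl fullv iN)) ?memv_amul ?memvf.
  case/negP: wN; move: (iterM m) (iterN m); rewrite m0 memv0 => /eqP->.
  rewrite sub0r memvN => /(memvZ (c ^+ m)^-1).
  by rewrite scalerA mulVf ?scale1r // expf_neq0.
apply/mulvP => u v uM /vlineP[c ->].
by rewrite linearZ memvZ ?Mw.
Qed.

Lemma nilpotent_ideal_addv M N U w :
    nilpotent_ideal M -> is_ideal N -> (N <= M)%VS ->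
    mulv U N = 0%VS -> (mulv U fullv <= <[w]> + N)%VS ->
    (mulv (M + U) <[w]> <= N)%VS -> (<[w]> <= U + N)%VS ->
  nilpotent_ideal (M + U)%VS.
Proof.
move=> /nilpotent_idealP[iM [m m0]] iN sNM UN UE Mw wU.
pose W := (<[w]> + N)%VS.
have sWMU : (W <= M + U)%VS.
  rewrite subv_add (subv_trans sNM) ?addvSl // andbT.
  by rewrite (subv_trans wU) // addvC addvS.
have UV V : (mulv U V <= W)%VS by apply: subv_trans UE; rewrite mulvS ?subvf.
apply/nilpotent_idealP; split.
  rewrite /is_ideal mulvDr subv_add (subv_trans iM) ?addvSl //=.
  by rewrite mulv_comm (subv_trans UE).
have MUW : (mulv (M + U) W <= N)%VS.
  by rewrite mulvDr subv_add Mw ideal_mulvl.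
(* The shift by one is needed because [U] itself need not lie in [M + W], whereas any product with a
   factor in [U] lies in [W]. *)
have low j : (lpow (M + U) j.+1 <= lpow M j + W)%VS.
  elim: j => [|j IH] /=.
    by rewrite mulvDl subv_add (subv_trans (UV _)) ?addvSr //
      (subv_trans (ideal_mulvr _ iM)) ?addvSl.
  apply: subv_trans (mulvS (subvv _) IH) _.
  rewrite mulvDr subv_add mulvDl subv_add addvSl /=.
  by rewrite (subv_trans (UV _)) ?addvSr ?(subv_trans MUW) //
    (subv_trans (addvSr <[w]> N)) ?addvSr.
(* At index [m.+1] only [W] is left, since [lpow M m] vanishes, and one more factor lands in [N].
   From there [U] acts by zero, so each further factor comes from [M]. *)
have high j : (lpow (M + U) (j + m.+2) <= N :&: lpow M j)%VS.
  elim: j => [|j].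
    have sN : (lpow (M + U) m.+2 <= N)%VS.
      apply: subv_trans (mulvS (subvv _) (low m)) _.
      by rewrite m0 add0v.
    by rewrite subv_cap sN (subv_trans sN).
  rewrite subv_cap => /andP[sN sM].
  rewrite addSn [lpow _ _.+1]/= -/(lpow _ _).
  rewrite mulvDl [mulv U _](_ : _ = 0%VS) ?addv0.
    by rewrite subv_cap mulvS // (subv_trans (mulvS (subvv _) sN)) ?ideal_mulvl.
  by apply/eqP; rewrite -subv0 -UN mulvS.
exists (m + m.+2)%N; apply/eqP; rewrite -subv0.
by apply: subv_trans (high m) _; rewrite m0 capvSr.
Qed.

(** * The nilradical when all products lie on a line *)

Section OneDimensionalDerived.
Variable w : A.
Hypotheses (w_neq0 : w != 0) (ww0 : amul w w = 0).
Hypothesis derived_w : forall u v, amul u v \in <[w]>%VS.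

Let ideal0 : is_ideal (0 : {vspace A})%VS.
Proof. by have [] := @nilpotent_ideal0 K A. Qed.

(** This is [nilpotent_ideal_mul_line] with the zero ideal as [N]. *)
Lemma Nil_mul_line : mulv (Defs.Nil A) <[w]> = 0%VS.
Proof.
have [nilA _] := @NilP K A; apply/eqP; rewrite -subv0.
apply: nilpotent_ideal_mul_line => //; rewrite ?sub0v ?memv0 //.
by rewrite addv0; apply/mulvP.
Qed.

(** Adjoining [w] to the nilradical keeps it nilpotent: products lie in [<[w]>], and both the
    nilradical and [w] annihilate [w], so left-normed products of three factors vanish. Maximality
    then absorbs [w]. *)
Lemma mem_Nil : w \in Defs.Nil A.
Proof.
have [nilA maxA] := @NilP K A; have [iA _] := nilA.
suff nilw : nilpotent_ideal (Defs.Nil A + <[w]>)%VS.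
  by rewrite -(maxA _ nilw (addvSl _ _)) memvE addvSr.
have mulw U V : (mulv U V <= <[w]>)%VS by apply/mulvP.
apply/nilpotent_idealP; split.
  by rewrite /is_ideal (subv_trans (mulw _ _)) ?addvSr.
exists 2; apply/eqP; rewrite -subv0.
apply: subv_trans (mulvS (subvv _) (mulw _ _)) _.
rewrite mulvDl Nil_mul_line add0v; apply/mulvP => _ _ /vlineP[a ->] /vlineP[b ->].
by rewrite linearZ /= amulC linearZ /= ww0 !scaler0 mem0v.
Qed.

End OneDimensionalDerived.

End Nilpotent.

(** * Lifting the summands and climbing the series *)

Section Series.
Variables (K : fieldType) (E : calgebra K) (n : nat) (B : n.-tuple E).
Hypothesis natB : natural_basis B.
Implicit Types (u v w : E) (U V M N : {vspace E}).

(** A lift of [EJ B N w] to [E], the same for every [N]. *)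
Definition supp_span w : {vspace E} := <<[seq B`_k | k : 'I_n in supp B w]>>%VS.

Lemma coord_sum u : u = \sum_(i < n) coord B i u *: B`_i.
Proof. by apply: coord_basis (memvf u); case: natB. Qed.

Lemma mem_supp_span w k : k \in supp B w -> B`_k \in supp_span w.
Proof. by move=> kw; apply/memv_span/image_f. Qed.

Lemma mem_supp_span_self w : w \in supp_span w.
Proof.
rewrite {1}(coord_sum w) memv_suml // => i _.
have [/mem_supp_span Bi|] := boolP (i \in supp B w); first exact: memvZ.
by rewrite inE negbK => /eqP->; rewrite scale0r mem0v.
Qed.

Lemma mul_supp_span w u k :
  u \in supp_span w -> k \notin supp B w -> amul u B`_k = 0.
Proof.
move=> uw kw; rewrite amulC; apply/eqP; rewrite -memv0 -lfunE memv_preim.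
apply: subvP uw; apply/span_subvP => _ /imageP[l lw ->].
rewrite -memv_preim lfunE /= memv0; apply/eqP; have [_ ->] := natB => //.
by apply: contraNneq kw => ->.
Qed.

(** In the expansion of [v] in [N], a basis vector indexed outside [supp B w] is killed by
    [supp_span w], and one indexed inside has coefficient zero by disjointness. *)
Lemma mul_disjoint_supp w N :
  [disjoint supp B w & suppv B N] -> mulv (supp_span w) N = 0%VS.
Proof.
move=> dis; apply/eqP; rewrite -subv0; apply/mulvP => u v uw vN.
rewrite (coord_sum v) linear_sum memv_suml // => i _; rewrite linearZ /=.
have [iw|iw] := boolP (i \in supp B w); last first.
  by rewrite (mul_supp_span uw iw) scaler0 mem0v.
have [->|vi] := eqVneq (coord B i v) 0; first by rewrite scale0r mem0v.
have /negP[] := disjointFr dis iw.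
by rewrite inE; apply/asboolP; exists v; rewrite ?inE.
Qed.

Lemma preim_quo_pi N U : (quo_pi N @^-1: (quo_pi N @: U))%VS = (U + N)%VS.
Proof.
apply: subv_anti; apply/andP; split; apply/subvP => u.
  rewrite -memv_preim => /memv_imgP[v vU /eqP].
  rewrite -subr_eq0 -linearB quo_pi_eq0 => uvN.
  by rewrite -(subrK v u) addrC memv_add.
case/memv_addP => v vU [x xN ->]; rewrite -memv_preim linearD /=.
have /eqP-> : quo_pi N x == 0 by rewrite quo_pi_eq0.
by rewrite addr0 memv_img.
Qed.

(** Treats both types of summand at once, restating them in [E] as the conditions that
    [nilpotent_ideal_addv] consumes. *)
Lemma summand_lift N (V : {vspace quoalg N}) :
    is_ideal N -> summand B V -> exists U w,
  [/\ w \notin N, (mulv fullv <[w]> <= <[w]> + N)%VS,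
      [/\ mulv U N = 0%VS, (mulv U fullv <= <[w]> + N)%VS
        & (mulv U <[w]> <= N)%VS],
      (<[w]> <= U + N)%VS
    & (quo_pi N @^-1: V)%VS = (U + N)%VS].
Proof.
move=> iN [w [idJ dimJ wwN dis] typeV].
have wN : w \notin N.
  apply/negP => wN; move: dimJ; rewrite /extension (addv_idPr _) -?memvE //.
  by move/eqP; rewrite -[X in X == _]add0n eqn_add2r.
have EJE : EJ B N w = (quo_pi N @: supp_span w)%VS.
  by rewrite limg_span -map_comp.
have JE : Jbar N w = <[quo_pi N w]>%VS.
  rewrite /Jbar limgD limg_line.
  suff -> : (quo_pi N @: N = 0)%VS by rewrite addv0.
  by apply/eqP; rewrite -lkerE quo_pi_ker.
have preJ u : quo_pi N u \in Jbar N w -> u \in (<[w]> + N)%VS.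
  rewrite memv_preim preim_quo_pi /extension -addvA.
  by rewrite (addv_idPl (subvv N)).
have w_span := mem_supp_span_self w.
have wEJ : quo_pi N w \in EJ B N w by rewrite EJE memv_img.
(* The only facts in which the two types differ. In type (b), products within [EJ] lie in its
   derived algebra [Jbar], and the nilradical kills [w]; in type (a), [Jbar] annihilates
   everything. *)
have [sVEJ wV UE Uw] : [/\ (V <= EJ B N w)%VS, quo_pi N w \in V,
   forall u k, u \in supp_span w -> quo_pi N u \in V -> k \in supp B w ->
      amul u B`_k \in (<[w]> + N)%VS
 & forall u, quo_pi N u \in V -> amul u w \in N].
  case: typeV => -[typeV ->].
    have [idEJ _ JbarE] := typeV.
    have EJEJ : (mulv (EJ B N w) (EJ B N w) <= EJ B N w)%VS.
      exact: ideal_mulvl.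
    pose w' : subalg (EJ B N w) := vsproj (EJ B N w) (quo_pi N w).
    have inclw : sub_incl (EJ B N w) w' = quo_pi N w.
      by rewrite sub_inclE vsprojK.
    have mulJ x y : amul x y \in <[w']>%VS.
      have : sub_incl (EJ B N w) (amul x y) \in Jbar N w.
        by rewrite JbarE memv_img // memv_amul ?memvf.
      rewrite JE -inclw => /vlineP[c].
      by rewrite -linearZ => /sub_incl_inj->; rewrite memvZ ?memv_line.
    have w'0 : w' != 0.
      apply: contraNneq wN => w'0.
      by rewrite -quo_pi_eq0 -inclw w'0 linear0.
    have w'w' : amul w' w' = 0.
      apply: (@sub_incl_inj _ _ (EJ B N w)); rewrite sub_inclM // inclw linear0.
      by apply/eqP; rewrite -quo_piM // quo_pi_eq0.
    split.
    - by apply/subvP => _ /memv_imgP[x _ ->]; apply: sub_incl_in.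
    - by rewrite -inclw memv_img // mem_Nil.
    - move=> u k uw _ kw; apply: preJ; rewrite quo_piM //.
      have uEJ : quo_pi N u \in EJ B N w by rewrite EJE memv_img.
      have kEJ : quo_pi N B`_k \in EJ B N w by rewrite EJE memv_img ?mem_supp_span.
      rewrite -(vsprojK uEJ) -(vsprojK kEJ) -!sub_inclE -sub_inclM // JbarE.
      by rewrite memv_img // memv_amul ?memvf.
    - move=> u /memv_imgP[x xNil ux].
      rewrite -quo_pi_eq0 quo_piM // ux -inclw -sub_inclM //.
      suff /eqP-> : amul x w' == 0 by rewrite linear0.
      rewrite -memv0 -(Nil_mul_line w'0 mulJ).
      by rewrite memv_amul ?memv_line.
  have annV u v : quo_pi N u \in Jbar N w -> amul u v \in N.
    by move=> uJ; rewrite -quo_pi_eq0 quo_piM // typeV.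
  split=> [||u k _ uJ _|u uJ]; rewrite ?JE -?memvE ?memv_line //.
    by rewrite (subvP (addvSr _ _)) // annV.
  exact: annV.
(* Cutting the preimage down to [supp_span w] makes [U] annihilate [N]; since [V] lies in
   [EJ B N w], adding [N] recovers the whole preimage. *)
pose U := ((quo_pi N @^-1: V) :&: supp_span w)%VS.
have wU : w \in U by rewrite memv_cap -memv_preim wV.
exists U, w; split=> //.
- apply: subv_trans idJ; rewrite mulvS //; exact: addvSl.
- split.
  + apply/eqP; rewrite -subv0 -(mul_disjoint_supp dis).
    by rewrite mulvS ?capvSr.
  + apply/mulvP => u v; rewrite memv_cap -memv_preim => /andP[uV uw] _.
    rewrite (coord_sum v) linear_sum memv_suml // => i _; rewrite linearZ memvZ //=.
    have [iw|iw] := boolP (i \in supp B w); first exact: UE.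
    by rewrite (mul_supp_span uw) ?mem0v.
  + apply/mulvP => u v; rewrite memv_cap -memv_preim => /andP[uV _] /vlineP[c ->].
    by rewrite linearZ memvZ ?Uw.
- by rewrite -memvE (subvP (addvSl _ _)).
apply: subv_anti; apply/andP; split.
  apply/subvP => v; rewrite -memv_preim => vV.
  have := subvP sVEJ _ vV; rewrite EJE => /memv_imgP[u uw vu].
  rewrite -(subrK u v) addrC memv_add //.
    by rewrite memv_cap -memv_preim -vu vV.
  by rewrite -quo_pi_eq0 linearB /= vu subrr.
rewrite subv_add capvSl; apply/subvP => x xN; rewrite -memv_preim.
by have /eqP-> : quo_pi N x == 0; rewrite ?quo_pi_eq0 ?mem0v.
Qed.

Lemma series_step_ideal N : is_ideal N -> is_ideal (series_step B N).
Proof.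
move=> iN; have [ubS minS] := vsumP (@summand K E n B N).
apply/mulvP => u v _; rewrite -!memv_preim quo_piM // => vS.
(* The sum is known only as a least upper bound, so stability under [L] is obtained by bounding each
   summand by the preimage of the sum under [L]. *)
pose L : 'End(quoalg N) := linfun (amul (quo_pi N u)).
suff /minS/subvP/(_ _ vS) : forall V : {vspace quoalg N}, summand B V ->
    (V <= L @^-1: vsum (@summand K E n B N))%VS.
  by rewrite -memv_preim lfunE.
move=> V sV; apply/subvP => x xV; rewrite -memv_preim.
have -> : L x = quo_pi N (amul u (vsval x)).
  by rewrite quo_piM // quo_pi_val lfunE.
apply: (subvP (ubS V sV)).
have [U [w [_ _ [_ UE _] wU preV]]] := summand_lift iN sV.
rewrite memv_preim preV.
have : vsval x \in (U + N)%VS by rewrite -preV -memv_preim quo_pi_val.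
apply: (mulvP fullv (U + N)%VS (U + N)%VS _); rewrite ?memvf //.
rewrite mulvDr subv_add (subv_trans iN) ?addvSr // andbT mulv_comm.
by rewrite (subv_trans UE) // subv_add wU addvSr.
Qed.

Lemma series_step_sub_maximal M N :
    maximal_nilpotent_ideal M -> is_ideal N -> (N <= M)%VS ->
  (series_step B N <= M)%VS.
Proof.
move=> [nilM maxM] iN sNM; have [_ minS] := vsumP (@summand K E n B N).
rewrite -(addv_idPl sNM) -preim_quo_pi lpreimS //; apply: minS => V sV.
have [U [w [wN wE [UN UE Uw] wU preV]]] := summand_lift iN sV.
have Mw : (mulv M <[w]> <= N)%VS.
  by apply: nilpotent_ideal_mul_line => //; apply: subv_trans wE; rewrite mulvS ?subvf.
have MUw : (mulv (M + U) <[w]> <= N)%VS by rewrite mulvDl subv_add Mw.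
have nilMU := nilpotent_ideal_addv nilM iN sNM UN UE MUw wU.
(* Maximality of [M] absorbs the lift [U], hence the summand [V], which is the image of [U + N]. *)
have sUM : (U <= M)%VS by rewrite -(maxM _ nilMU (addvSl _ _)) addvSr.
rewrite -[V](@lpreimK _ _ _ (quo_pi N)) ?quo_pi_img ?subvf // preV.
by rewrite limgS // subv_add sUM.
Qed.

Lemma nil_series_ideal i : is_ideal (nil_series B i).
Proof.
elim: i => [|i IH]; first by have [] := @nilpotent_ideal0 K E.
exact: series_step_ideal.
Qed.

Lemma nil_series_sub_maximal M i :
  maximal_nilpotent_ideal M -> (nil_series B i <= M)%VS.
Proof.
move=> maxM; elim: i => [|i IH]; first exact: sub0v.
exact: series_step_sub_maximal (nil_series_ideal i) IH.
Qed.

End Series.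

Theorem proposition3p13 (K : fieldType) (charK : 2%N \notin [pchar K])
    (E : calgebra K) (n : nat) (B : n.-tuple E) (natB : natural_basis B)
    (r : nat) (r_stab : stabilises_at B r) (I : {vspace E}) :
  nilpotent_ideal I -> nilpotent_ideal (I + nil_series B r)%VS.
Proof.
move=> nilI; have [M maxM sIM] := maximal_nilpotent_ideal_above nilI.
have [nilM _] := maxM; have [iI _] := nilI.
(* Nilpotency is inherited from [M], so the sum only has to be an ideal contained in [M]. *)
apply: nilpotent_idealS nilM; first by apply/ideal_addv/nil_series_ideal.
by rewrite subv_add sIM nil_series_sub_maximal.
Qed.
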